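(* Let $A$ be a kneading automaton over $X=\{0,1\}$ with pre-periodic kneading sequence, let $\widehat{\ell}:A-\{id\}\to\mathbb{R}^{+}$ be a weight function and $T$ a choice of minimal representatives such that the induced length function $\ell$ is admissible. For $i=1,\dots,n$, let $u_i$ be a word that is good at depth $m_i$, and let $\mathcal{U}=\{u_1,\dots,u_n\}$. If there is some $M>0$ such that, for all $L>0$, there are at most $M$ $\mathcal{U}$-bad words $w$ of length $L$ (i.e. with $\ell(w)=L$), then $G(A)$ has subexponential growth.
   Context: Automata. $X=\{0,1\}$; $X^{*}$ is the free monoid on $X$, viewed as a rooted binary tree. An automaton $A$ over $X$ is a finite set of states (also denoted $A$) with a map $\tau:A\times X\to X\times A$, written $\tau(a,x)=(\tau_a(x),a_{|x})$. Each state acts on $X^{*}$ by $a(\emptyset)=\emptyset$, $a(xw)=\tau_a(x)\,a_{|x}(w)$. A state $a$ is active if $\tau_a\ne\mathrm{id}_X$; $A$ is invertible if every $\tau_a$ is a bijection, and reduced if distinct states induce distinct maps on $X^{*}$. The identity state $id$ is the state acting as the identity. $G(A)\le\mathrm{Aut}(X^{*})$ is the group generated by the states. The Moore diagram has the states as vertices and, for each $a\in A,x\in X$, an arrow from $a$ to $a_{|x}$ labelled $(x,\tau_a(x))$. $A$ is a kneading automaton if it is invertible and reduced, there is exactly one active state $t$, each non-identity state has exactly one incoming arrow, and at most one arrow out of the active state leads to a non-identity state. Deleting $id$ and all arrows into it leaves a graph that is topologically either a circle or a circle with an arc (sticker) attached; the kneading sequence is pre-periodic in the second case. Then $t$ is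 the free endpoint of the arc, $t(0w)=1w$, $t(1w)=0w$, and all non-identity states have order 2 in $G(A)$. Lengths. $S=A-\{t,id\}$, $H=\langle S\rangle\le G(A)$. Given $\widehat{\ell}:A-\{id\}\to\mathbb{R}^{+}$ and $w=a_1\cdots a_n\in(A-\{id\})^{*}$, put $|w|=\sum\widehat{\ell}(a_i)$ and $\ell(w)=\min\{|v|: v\in(A-\{id\})^{*},\ v=w\text{ in }G(A)\}$; $C=\ell(t)$. $T$ is a set consisting of one word $w_h\in S^{*}$ for each $h\in H$, such that $w_h=h$ in $G(A)$ and $|w_h|\le|\widehat w|$ for every $\widehat w\in S^{*}$ representing $h$. The map $r:(A-\{id\})^{*}\to(A-\{id\})^{*}$ replaces each maximal subword over $S$ by its representative in $T$, without cancelling any $t$'s. A word is in weak reduced form if it lies in the image of $r$. For $w$ in weak reduced form with maximal $S$-blocks $w_1,\dots,w_m$ separated by (and possibly preceded or followed by) maximal blocks of $t$'s, $|w|_{*}=C\cdot(\text{number of maximal blocks of }t\text{'s})+\sum_{i=1}^{m}|w_i|$. Productions. $(g_0,g_1)$ denotes the automorphism $jw\mapsto j\,g_j(w)$. The first-line string production of $w\in(A-\{id\})^{*}$ is obtained by replacing each letter $s\in S$ by the pair $(s_{|0},s_{|1})$, moving all $t$'s to the right end via $t(\alpha,\beta)=(\beta,\alpha)t$ (and reducing the power of $t$ mod 2), and multiplying the pairs coordinatewise in the free monoid $(A-\{id\})^{*}$ (occurrences of $id$ omitted, no cancellation); it has the form $(\widetilde w_0,\widetilde w_1)$ or $(\widetilde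 w_0,\widetilde w_1)t$. The first-line production of $w$ is $(w_0,w_1)$ (resp. $(w_0,w_1)t$) with $w_j=r(\widetilde w_j)$. The length function $\ell$ is admissible if $|t|+|w|\ge|w_0|+|w_1|$ for all $w\in T$. Good words. A subword of a word in weak reduced form is protected if it begins and ends with $t$ and contains at least one letter of $S$. Write $\widehat w\preccurlyeq w$ if there is a protected subword $\widetilde w$ of $w$ such that $\widehat w$ is a protected subword of one of the two words in the first-line production of $\widetilde w$. A subword $v$ of a word $w$ in weak reduced form is reducing if $v=tw_1tw_2\cdots tw_q$ with $q\ge1$, each $w_i\in T$, $w_q$ is followed immediately by a $t$ in $w$, and $\ell(v_0)+\ell(v_1)<|v|_{*}$. A word $u$ is good at depth $m$ ($m\ge0$) if there are $u\succcurlyeq u_1\succcurlyeq\cdots\succcurlyeq u_m$ such that $u_m$ (or $u$ itself if $m=0$) contains a reducing subword. A word $w\in(A-\{id\})^{*}$ is reduced if $|w|=\ell(w)$. A reduced word $w$ is $\mathcal{U}$-bad if no word of $\mathcal{U}$ occurs as a subword of $w$. Subexponential growth of a finitely generated group means $\lim_{n\to\infty}|B(n)|^{1/n}=1$ for balls $B(n)$ in a word metric. *)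

(* Defs.v *)
From mathcomp Require Import all_boot all_order all_algebra.
From mathcomp Require Import finmap.
From mathcomp Require Import all_classical all_reals all_analysis.
Import Order.TTheory GRing.Theory Num.Theory.
Import numFieldNormedType.Exports.

Set Implicit Arguments.
Unset Strict Implicit.
Unset Printing Implicit Defensive.

Local Open Scope classical_set_scope.
Local Open Scope ring_scope.

(* The alphabet X = {0, 1} is [bool], with 0 = false and 1 = true. *)
Record automaton := Automaton {
  state :> finType;
  tau : state -> bool -> bool * state }.

Definition out (A : automaton) (a : A) (x : bool) : bool := (tau a x).1.
Definition sec (A : automaton) (a : A) (x : bool) : A := (tau a x).2.

Fixpoint act (A : automaton) (a : A) (w : seq bool) : seq bool :=
  if w is x :: w' then out a x :: act (sec a x) w' else [::].

(* Groups act on the left: the word a_1 ... a_n maps x to a_1 (... (a_n x)).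
   Two words are equal in G(A) iff their [eval]s are equal. *)
Definition eval (A : automaton) (w : seq A) : seq bool -> seq bool :=
  fun x => foldr (@act A) x w.

(* Subgroups of Aut(X^* ), as sets of maps X^* -> X^*. *)
Inductive generated (E : set (seq bool -> seq bool)) :
    set (seq bool -> seq bool) :=
| gen_mem f : E f -> generated E f
| gen_one : generated E id
| gen_mul f g : generated E f -> generated E g -> generated E (f \o g)
| gen_inv f g : generated E f -> cancel f g -> cancel g f -> generated E g.

Definition group_of (A : automaton) : set (seq bool -> seq bool) :=
  generated (range (@act A)).

Definition word_ball (E : set (seq bool -> seq bool)) (n : nat) :
    set (seq bool -> seq bool) :=
  [set f | exists s : seq (seq bool -> seq bool),
     [/\ (size s <= n)%N,
         forall g, g \in s ->
           E g \/ exists h, [/\ E h, cancel h g & cancel g h] &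
         f = foldr (fun g h => g \o h) id s]].

Definition subexponential_growth (R : realType)
    (G : set (seq bool -> seq bool)) : Prop :=
  exists E : set (seq bool -> seq bool),
    [/\ finite_set E, generated E = G &
        (#|` fset_set (word_ball E n)|%:R : R) `^ (n%:R^-1) @[n --> \oo]
          --> (1 : R)].

Section Kneading.
Context (A : automaton).

Definition active (a : A) : Prop := exists x, out a x <> x.

Definition invertible : Prop := forall a : A, bijective (out a).

Definition reduced_automaton : Prop :=
  forall a b : A, act a =1 act b -> a = b.

Definition is_identity (a : A) : Prop := forall w, act a w = w.

(* The arrows of the Moore diagram are the pairs (a, x), from a to sec a x. *)
Definition kneading : Prop :=
  [/\ invertible, reduced_automaton,
      exists! t : A, active t,
      forall a : A, ~ is_identity a ->
        #|[set p : A * bool | sec p.1 p.2 == a]%SET| = 1%N &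
      forall (t : A), active t -> forall x y,
        ~ is_identity (sec t x) -> ~ is_identity (sec t y) -> x = y].

(* The non-identity part of the Moore diagram is a circle [c] with an arc
   b :: p attached at a vertex b of [c]. Arrows are counted with multiplicity.
   In a kneading automaton every non-identity state has one incoming arrow, so
   the circle is necessarily a directed cycle and the arc is directed away from
   it. *)
Definition preperiodic : Prop :=
  exists (c p : seq A) (b : A),
    [/\ p <> [::], uniq (c ++ p), b \in c,
        forall a, a \in c ++ p <-> ~ is_identity a &
        forall a a', a \in c ++ p -> a' \in c ++ p ->
          #|[set x : bool | sec a x == a']%SET| =
          ((a \in c) && (a' == path.next c a) +
           ((a, a') \in zip (b :: p) p))%N].

End Kneading.

(* [e] is the identity state and [t] the active state. *)
Section Words.
Context (A : automaton) (e t : A).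

Definition is_word (w : seq A) : bool := e \notin w.

Definition is_Sword (w : seq A) : bool := (e \notin w) && (t \notin w).

Definition H_of : set (seq bool -> seq bool) :=
  generated [set act a | a in [set a : A | a != e /\ a != t]].

(* [strprod j w] is the j-th coordinate of the first-line string production of
   w: t (g_0, g_1) = (g_1, g_0) t exchanges the coordinates of whatever
   follows. *)
Fixpoint strprod (j : bool) (w : seq A) : seq A :=
  if w is a :: w' then
    if a == t then strprod (~~ j) w'
    else if sec a j == e then strprod j w'
    else sec a j :: strprod j w'
  else [::].

Section Lengths.
Context (R : realType) (wt : A -> R).

Definition wlen (w : seq A) : R := \sum_(a <- w) wt a.

(* For positive weights only finitely many words have length below a given
   bound, so that this infimum is a minimum. *)
Definition ell (w : seq A) : R :=
  inf [set wlen v | v in [set v | is_word v /\ eval v = eval w]].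

Definition reduced_word (w : seq A) : Prop := is_word w /\ wlen w = ell w.

(* A maximal block of t's is counted at its first letter, i.e. at a t which is
   the first letter of w or preceded by another letter. *)
Definition ntblocks (w : seq A) : nat :=
  count (fun p => (p.1 != t) && (p.2 == t)) (zip (e :: w) w).

Definition starlen (w : seq A) : R :=
  ell [:: t] * (ntblocks w)%:R + wlen [seq a <- w | a != t].

Definition bad_word (U : set (seq A)) (w : seq A) : Prop :=
  reduced_word w /\ forall u, U u -> ~~ infix u w.

(* The choice of representatives h |-> w_h; only its values on H matter. *)
Context (rep : (seq bool -> seq bool) -> seq A).

Definition minimal_reps : Prop :=
  forall h, H_of h ->
    [/\ is_Sword (rep h), eval (rep h) = h &
        forall v, is_Sword v -> eval v = h -> wlen (rep h) <= wlen v].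

Definition T_of : set (seq A) := rep @` H_of.

(* [b] is the part already read of the current block over S. An empty block is
   left empty: the minimal representative of 1 is the empty word. *)
Fixpoint rmap_from (b w : seq A) : seq A :=
  if w is a :: w' then
    if a == t then rep (eval b) ++ t :: rmap_from [::] w'
    else rmap_from (rcons b a) w'
  else rep (eval b).

Definition rmap (w : seq A) : seq A := rmap_from [::] w.

Definition weak_reduced (w : seq A) : Prop :=
  exists2 v, is_word v & w = rmap v.

Definition production (j : bool) (w : seq A) : seq A := rmap (strprod j w).

Definition admissible : Prop :=
  forall w, T_of w ->
    wlen (production false w) + wlen (production true w) <= wt t + wlen w.

Definition protected_subword (v w : seq A) : Prop :=
  [/\ weak_reduced w, infix v w, (exists v', v = t :: v'),
      (exists v', v = rcons v' t) & has (fun a => (a != e) && (a != t)) v].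

Definition preceq (w' w : seq A) : Prop :=
  exists v, protected_subword v w /\
    exists j, protected_subword w' (production j v).

(* The words w_i of T may be empty. *)
Definition reducing_subword (v w : seq A) : Prop :=
  [/\ weak_reduced w,
      (exists x y, w = x ++ v ++ t :: y),
      (exists ws : seq (seq A),
         [/\ ws <> [::], forall w_i, w_i \in ws -> T_of w_i &
             v = flatten [seq t :: w_i | w_i <- ws]]) &
      ell (production false v) + ell (production true v) < starlen v].

Fixpoint good (m : nat) (u : seq A) : Prop :=
  if m is m'.+1 then exists2 u', preceq u' u & good m' u'
  else exists v, reducing_subword v u.

End Lengths.
End Words.

(* Main.v *)
(* Let the level-D length of g be the sum of the lengths of its sections at the
   vertices of level D. Admissibility bounds the two productions of w by
   |w| + |t|, so the level-D length is at most |w| + (2^D - 1)|t|. A disjoint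
   occurrence in w of a word that is good at depth m < D passes to m successive
   productions and then lowers the estimate by a fixed amount, so k disjoint
   occurrences give level-D length at most |w| + c - eps k.
   For s > 0 let Z(s) be the sum of exp (- s l(g)) over the group. Cutting a
   reduced word at occurrences of the u_i leaves bad factors; these are
   determined up to M choices by their letter counts, so the words with few cuts
   contribute a finite sum for every s > 0. The words with many cuts have level-D
   length at most (1 - delta) l(g) + c, and g is determined by its sections and
   their permutation, so their sum at (1 - delta) s is finite as soon as Z(s) is.
   Iterating, Z(s) is finite for all s > 0, which is subexponential growth. *)
Require Import Defs.
From mathcomp Require Import all_boot all_order all_algebra.
From mathcomp Require Import finmap.
From mathcomp Require Import all_classical all_reals all_analysis.
From mathcomp Require Import lra zify.
Import Order.TTheory GRing.Theory Num.Theory.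
Import numFieldNormedType.Exports.

Set Implicit Arguments.
Unset Strict Implicit.
Unset Printing Implicit Defensive.

Local Open Scope classical_set_scope.
Local Open Scope ring_scope.
Local Notation eval := Defs.eval.

(** * Finite sums bounded uniformly over finite subfamilies *)

Section SumBounded.
Context {R : realType}.

(** For nonnegative [f] this bounds the unordered sum over [P]. Only finite duplicate-free families
    occur, so no enumeration and no convergence argument is involved. *)
Definition sum_bounded (T : eqType) (P : T -> Prop) (f : T -> R) (Z : R) :=
  forall F : seq T, uniq F -> (forall x, x \in F -> P x) ->
    \sum_(x <- F) f x <= Z.

Lemma sum_bounded_ge0 (T : eqType) (P : T -> Prop) f Z :
  sum_bounded P f Z -> 0 <= Z.
Proof. by move=> /(_ [::] isT); rewrite big_nil; apply. Qed.

Lemma sum_bounded_inj (T U : eqType) (phi : T -> U) (P : T -> Prop)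
    (Q : U -> Prop) (f : T -> R) (g : U -> R) Z :
  (forall x y, P x -> P y -> phi x = phi y -> x = y) ->
  (forall x, P x -> Q (phi x) /\ f x <= g (phi x)) ->
  sum_bounded Q g Z -> sum_bounded P f Z.
Proof.
move=> inj PQ bQ F uF FP.
have /bQ : uniq (map phi F).
  by rewrite map_inj_in_uniq // => x y /FP Px /FP Py; exact: inj.
move=> /(_ _)/le_trans H; rewrite big_map in H.
apply: (le_trans _ (H _ _ (lexx _))).
  by rewrite !big_seq; apply: ler_sum => x /FP/PQ[].
by move=> y /mapP[x /FP/PQ[Qx _] ->].
Qed.

Lemma sum_bounded_le (T : eqType) (P Q : T -> Prop) (f g : T -> R) Z :
  (forall x, P x -> Q x /\ f x <= g x) ->
  sum_bounded Q g Z -> sum_bounded P f Z.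
Proof. by move=> PQ; exact: (@sum_bounded_inj _ _ id). Qed.

Lemma sum_boundedD (T : eqType) (P : T -> Prop) (f g : T -> R) Z Y :
  sum_bounded P f Z -> sum_bounded P g Y ->
  sum_bounded P (fun x => f x + g x) (Z + Y).
Proof. by move=> bf bg F uF FP; rewrite big_split lerD ?bf ?bg. Qed.

Lemma sum_boundedZ (T : eqType) (P : T -> Prop) (f : T -> R) c Z :
  0 <= c -> sum_bounded P f Z -> sum_bounded P (fun x => c * f x) (c * Z).
Proof. by move=> c0 bf F uF FP; rewrite -mulr_sumr ler_wpM2l ?bf. Qed.

(** Tonelli for nested sums: a finite family of pairs is grouped by first coordinate, and each fibre
    is bounded on its own. *)
Lemma sum_bounded_dep (T U : eqType) (P : T -> Prop) (Q : T -> U -> Prop)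
    (f : T -> U -> R) (g : T -> R) Z :
  (forall x, P x -> sum_bounded (Q x) (f x) (g x)) -> sum_bounded P g Z ->
  sum_bounded (fun p => P p.1 /\ Q p.1 p.2) (fun p => f p.1 p.2) Z.
Proof.
move=> bf bg F uF FP.
have -> : \sum_(p <- F) f p.1 p.2 =
    \sum_(x <- undup (map fst F)) \sum_(p <- F | p.1 == x) f p.1 p.2.
  rewrite (exchange_big_dep xpredT) //= big_seq [RHS]big_seq.
  apply: eq_bigr => p pF.
  rewrite (eq_bigl (pred1 p.1)); last by move=> x; rewrite eq_sym.
  rewrite -big_filter filter_pred1_uniq ?undup_uniq ?mem_undup ?map_f //.
  by rewrite big_seq1.
apply: le_trans (bg (undup (map fst F)) (undup_uniq _) _); last first.
  by move=> x; rewrite mem_undup => /mapP[p /FP[Pp _] ->].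
rewrite !big_seq; apply: ler_sum => x; rewrite mem_undup => /mapP[p pF xE].
have Px : P x by rewrite xE; case: (FP _ pF).
pose Fx := [seq q <- F | q.1 == x].
have -> : \sum_(q <- F | q.1 == x) f q.1 q.2 = \sum_(y <- map snd Fx) f x y.
  rewrite big_map big_filter; apply: eq_bigr => q /eqP ->; done.
apply: bf => //.
  rewrite map_inj_in_uniq ?filter_uniq // => -[a b] [a' b'].
  by rewrite !mem_filter /= => /andP[/eqP -> _] /andP[/eqP -> _] ->.
by move=> y /mapP[q]; rewrite mem_filter => /andP[/eqP <- /FP[_ ?]] ->.
Qed.

Lemma sum_bounded_prod (T U : eqType) (P : T -> Prop) (Q : U -> Prop)
    (f : T -> R) (g : U -> R) Z Y :
  (forall x, 0 <= f x) -> sum_bounded P f Z -> sum_bounded Q g Y ->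
  sum_bounded (fun p => P p.1 /\ Q p.2) (fun p => f p.1 * g p.2) (Z * Y).
Proof.
move=> f0 bf bg.
apply: (@sum_bounded_dep _ _ P (fun=> Q) (fun x y => f x * g y)
  (fun x => Y * f x)).
  by move=> x Px; rewrite mulrC; exact: sum_boundedZ.
by rewrite mulrC; apply: sum_boundedZ => //; exact: sum_bounded_ge0 bg.
Qed.

Lemma ler_sum_uniq_subset (T : eqType) (f : T -> R) (F G : seq T) :
  (forall x, 0 <= f x) -> uniq F -> uniq G -> {subset F <= G} ->
  \sum_(x <- F) f x <= \sum_(x <- G) f x.
Proof.
move=> f0 uF uG FG; rewrite (bigID (mem F) (fun=> true)) /=.
rewrite [leRHS](bigID (mem F)) /= [X in X + _ <= _](_ : _ =
  \sum_(i <- G | i \in F) f i).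
  rewrite lerD2l [leLHS]big1_seq ?sumr_ge0 // => i /andP[/negP nF iF].
  by case: nF.
rewrite -[LHS]big_filter -[RHS]big_filter; apply: perm_big; apply: uniq_perm; rewrite ?filter_uniq //.
by move=> x; rewrite !mem_filter andbb; case: (boolP (x \in F)) => //= /FG ->.
Qed.

Lemma sum_bounded_fin (T : finType) (f : T -> R) :
  (forall x, 0 <= f x) -> sum_bounded (fun=> True) f (\sum_x f x).
Proof.
move=> f0 F uF _; rewrite -[leRHS]big_enum /=.
by apply: ler_sum_uniq_subset; rewrite ?enum_uniq // => x; rewrite mem_enum.
Qed.

Lemma sum_bounded_geometric (q : R) : 0 <= q < 1 ->
  sum_bounded (fun=> True) (fun i => q ^+ i) (1 - q)^-1.
Proof.
move=> /andP[q0 q1] F uF _.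
apply: (@le_trans _ _ (\sum_(i <- iota 0 (\max_(i <- F) i).+1) q ^+ i)).
  apply: ler_sum_uniq_subset; rewrite ?iota_uniq // => i; first exact: exprn_ge0.
  move=> iF; by rewrite mem_iota leq0n add0n ltnS leq_bigmax_seq.
rewrite -[_.+1]subn0 -/(index_iota _ _) big_mkord.
rewrite -[leRHS]mul1r ler_pdivlMr ?subr_gt0 // mulrC.
rewrite -[_ * _]opprK -mulNr opprB -subrX1 opprB gerBl.
exact: exprn_ge0.
Qed.

Lemma sum_bounded_seqk (T : eqType) (P : T -> Prop) (f : T -> R) Z k :
  (forall x, 0 <= f x) -> sum_bounded P f Z ->
  sum_bounded (fun s => size s = k /\ forall x, x \in s -> P x)
    (fun s => \prod_(x <- s) f x) (Z ^+ k).
Proof.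
move=> f0 bf; have Z0 := sum_bounded_ge0 bf; elim: k => [|k IH].
  move=> [|s [|s' F]] /=; rewrite ?big_nil // => uF FP.
    rewrite big_seq1; have [/size0nil -> _] := FP _ (mem_head _ _).
    by rewrite big_nil.
  have [/size0nil s0 _] := FP _ (mem_head _ _).
  have [/size0nil s'0 _] := FP s' (@mem_behead _ [:: s, s' & F] _ (mem_head _ _)).
  by rewrite s0 s'0 mem_head in uF.
(* A nonempty [F] starts with a nonempty list, whose head [x0] serves as the default value for
   [head]. *)
move=> F uF FP; case: F uF FP => [|[|x0 s0] F] uF FP.
- by rewrite big_nil exprn_ge0.
- by have [] := FP _ (mem_head _ _).
rewrite exprS; move: uF FP.
apply: (@sum_bounded_inj _ _ (fun s => (head x0 s, behead s)) _
  (fun p => P p.1 /\ (size p.2 = k /\ forall x, x \in p.2 -> P x))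
  _ (fun p => f p.1 * \prod_(x <- p.2) f x)); last exact: (sum_bounded_prod f0 bf IH).
  by move=> [|a s] [|b s'] [//= _ _] [//= _ _] [-> ->].
move=> [|a s] [//= [sk] sP]; rewrite big_cons; split => //; split.
  by apply: sP; rewrite mem_head.
by split=> // x xs; apply: sP; rewrite inE xs orbT.
Qed.

(** Recording the length of a list sorts the lists into fibres with sums at most [Z ^+ k], which
    form a geometric series. *)
Lemma sum_bounded_seq (T : eqType) (P : T -> Prop) (f : T -> R) Z :
  (forall x, 0 <= f x) -> Z < 1 -> sum_bounded P f Z ->
  sum_bounded (fun s : seq T => forall x, x \in s -> P x)
    (fun s => \prod_(x <- s) f x) (1 - Z)^-1.
Proof.
move=> f0 Z1 bf; have Z0 := sum_bounded_ge0 bf.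
have geo : sum_bounded (fun=> True) (fun i => Z ^+ i) (1 - Z)^-1.
  by apply: sum_bounded_geometric; rewrite Z0.
have := sum_bounded_dep (fun k _ => @sum_bounded_seqk _ _ _ _ k f0 bf) geo.
apply: (@sum_bounded_inj _ _ (fun s => (size s, s))) => //.
by move=> x y _ _ [].
Qed.
End SumBounded.

(** * Structure of kneading automata *)

Section Structure.
Context (A : automaton) (e t : A).
Hypotheses (hA : kneading A) (he : is_identity e) (ht : active t).

Lemma is_identityP (a : A) : is_identity a -> a = e.
Proof. by case: hA => _ red _ _ _ ida; apply: red => w; rewrite ida he. Qed.

Lemma out_inactive (a : A) x : a != t -> out a x = x.
Proof.
case: hA => _ _ [t' [_ uniq_t]] _ _ /eqP at_; apply: contrapT => ax.
by apply: at_; rewrite -(uniq_t _ ht); apply/esym/uniq_t; exists x.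
Qed.

Lemma out_active x : out t x = ~~ x.
Proof.
case: hA ht => inv _ _ _ _ [y yt]; have /bij_inj inj := inv t.
have := inj true false.
by case: x y yt => -[]; case: (out t true) (out t false) => [] [] //= _ /(_ erefl).
Qed.

Lemma active_neq_identity : e != t.
Proof.
by apply/eqP => et; have := he [:: true]; rewrite /= et out_active.
Qed.

Lemma mem_zip_belast (T : eqType) (b x y : T) (p : seq T) :
  (x, y) \in zip (b :: p) p -> x \in belast b p.
Proof.
elim: p b => //= a p IH b; rewrite !inE => /orP[/eqP[-> _]|/IH ->].
  by rewrite eqxx.
exact: orbT.
Qed.

(* The free endpoint of the arc has no arrow to a non-identity state, so it
   would be the identity if it were inactive. *)
Lemma sec_active x : preperiodic A -> sec t x = e.
Proof.
move=> [c [p [b [p0 ucp bc nid arr]]]].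
have [z [p' pE]] : exists z p', p = rcons p' z.
  by case/lastP: p p0 {ucp nid arr} => // p' z _; exists z, p'.
have zp : z \in p by rewrite pE mem_rcons mem_head.
have zcp : z \in c ++ p by rewrite mem_cat zp orbT.
have [uc /hasPn/(_ _ zp)/= zc up] := and3P (etrans (esym (cat_uniq c p)) ucp).
(* [z] is off the circle and is only the last vertex of the arc, so [arr] counts no arrow from it to
   a non-identity state. *)
have sec_z y : sec z y = e.
  apply: is_identityP; apply: contrapT => /nid scp.
  have := arr _ _ zcp scp.
  have -> : (z, sec z y) \in zip (b :: p) p = false.
    apply/negP => /mem_zip_belast; rewrite pE belast_rcons inE => /orP[/eqP zb|].
      by rewrite zb bc in zc.
    by apply/negP; move: up; rewrite pE rcons_uniq => /andP[].
  rewrite (negPf zc) => /eqP; rewrite cards_eq0 => /eqP/setP/(_ y).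
  by rewrite !inE eqxx.
have [<- //|zt] := eqVneq z t.
case/nid: zcp; case=> //= y w; rewrite out_inactive // sec_z.
by congr cons; exact: he.
Qed.
End Structure.

(** * Words and lengths *)

Section WordLemmas.
Context (A : automaton) (e t : A).
Implicit Types (w x y z b : seq A).

Lemma eval_cat x y : eval (x ++ y) = eval x \o eval y.
Proof. by apply/funext => z; rewrite /eval foldr_cat. Qed.

Lemma is_word_cat x y : is_word e (x ++ y) = is_word e x && is_word e y.
Proof. by rewrite /is_word mem_cat negb_or. Qed.

Lemma is_word_cons (a : A) x : is_word e (a :: x) = (a != e) && is_word e x.
Proof. by rewrite /is_word inE negb_or eq_sym. Qed.

Lemma is_Sword_cat x y : is_Sword e t (x ++ y) = is_Sword e t x && is_Sword e t y.
Proof. by rewrite /is_Sword !mem_cat !negb_or andbACA. Qed.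

Lemma is_SwordW x : is_Sword e t x -> is_word e x.
Proof. by case/andP. Qed.

Definition t_parity w := odd (count_mem t w).

Lemma parity_Sword x : is_Sword e t x -> t_parity x = false.
Proof. by case/andP => _; rewrite /t_parity => /count_memPn ->. Qed.

Lemma strprod_cat j x y :
  strprod e t j (x ++ y) = strprod e t j x ++ strprod e t (j (+) t_parity x) y.
Proof.
elim: x j => [|a x IH] j /=; first by rewrite addbF.
rewrite /t_parity /= oddD -/(t_parity x).
have [_|_] := eqVneq a t; first by rewrite IH addTb addbN addNb.
by rewrite addFb; case: ifP => _; rewrite IH.
Qed.

Lemma strprod_word j w : is_word e (strprod e t j w).
Proof.
elim: w j => //= a w IH j; case: eqP => // _; case: ifP => // nae.
by rewrite is_word_cons nae IH.
Qed.

Context (R : realType) (wt : A -> R).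
Hypothesis hwt : forall a : A, a != e -> 0 < wt a.

Lemma wlen_cat x y : wlen wt (x ++ y) = wlen wt x + wlen wt y.
Proof. by rewrite /wlen big_cat. Qed.

Lemma wlen_cons a x : wlen wt (a :: x) = wt a + wlen wt x.
Proof. by rewrite /wlen big_cons. Qed.

Lemma wlen_nil : wlen wt [::] = 0.
Proof. by rewrite /wlen big_nil. Qed.

Lemma wlen_ge0 w : is_word e w -> 0 <= wlen wt w.
Proof.
move=> ew; rewrite /wlen big_seq sumr_ge0 // => a aw; apply/ltW/hwt.
by apply: contraNneq ew => <-.
Qed.

Lemma wt_min : exists2 c : R, 0 < c & forall a, a != e -> c <= wt a.
Proof.
exists (\big[Num.min/1]_(a | a != e) wt a); last by move=> a ae; exact: bigmin_le_cond.
by apply: lt_bigmin.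
Qed.

Lemma wt_max : exists2 c : R, 0 < c & forall a, wt a <= c.
Proof.
exists (\big[Num.max/1]_a wt a); last by move=> a; exact: le_bigmax_cond.
by apply: lt_le_trans (bigmax_ge_id _ _ _ _).
Qed.

Lemma ell_has_lbound w :
  has_lbound [set wlen wt v | v in [set v | is_word e v /\ eval v = eval w]].
Proof. by exists 0 => _ [v [vw _] <-]; exact: wlen_ge0. Qed.

Lemma ell_le v w : is_word e v -> eval v = eval w -> ell e wt w <= wlen wt v.
Proof.
by move=> vw vE; apply: ge_inf; [exact: ell_has_lbound | exists v].
Qed.

Lemma wlen_ge_size (c : R) w : (forall a, a != e -> c <= wt a) ->
  is_word e w -> c * (size w)%:R <= wlen wt w.
Proof.
move=> cP; elim: w => [|a w IH]; first by rewrite mulr0 wlen_nil.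
rewrite is_word_cons => /andP[ae ww]; rewrite wlen_cons -natr1 mulrDr mulr1.
by rewrite addrC lerD ?cP ?IH.
Qed.

(** Weights are bounded below by some [c > 0], so words no longer than [w] have at most [N] letters.
    The minimum is taken over this finite type; longer words do not compete. *)
Lemma ell_attained w : is_word e w ->
  exists v, [/\ is_word e v, eval v = eval w & wlen wt v = ell e wt w].
Proof.
move=> ww; have [c c0 cP] := wt_min.
have size_le := fun v => @wlen_ge_size c v cP.
pose N := (Num.truncn (wlen wt w / c)).+1.
have small v : is_word e v -> wlen wt v <= wlen wt w -> (size v <= N)%N.
  move=> vw vle; rewrite -(ler_nat R).
  have : (size v)%:R <= wlen wt w / c.
    by rewrite ler_pdivlMr // mulrC (le_trans (size_le _ vw)).
  by move=> /le_trans; apply; exact/ltW/truncnS_gt.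
have wN : (size w <= N)%N by exact: small.
pose P (v : {bseq N of A}) := is_word e v && `[< eval v = eval w >].
have Pw : P (Bseq wN) by rewrite /P /= ww; exact/asboolP.
case: (arg_minP (fun v : {bseq N of A} => wlen wt v) Pw) => v /andP[vw /asboolP vE] vmin.
exists v; split => //; apply/eqP; rewrite eq_le ell_le // andbT.
apply: lb_le_inf => [|_ [x [xw xE] <-]]; first by exists (wlen wt w); exists w.
have [xle|/ltW] := leP (wlen wt x) (wlen wt w); last first.
  by apply: le_trans; exact: (vmin (Bseq wN)).
apply: (vmin (Bseq (small _ xw xle))).
by rewrite /P /= xw; exact/asboolP.
Qed.

Lemma eq_ell v w : eval v = eval w -> ell e wt v = ell e wt w.
Proof. by rewrite /ell => ->. Qed.

Lemma ell_cat x y : is_word e x -> is_word e y ->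
  ell e wt (x ++ y) <= ell e wt x + ell e wt y.
Proof.
move=> /ell_attained[x' [x'w x'E <-]] /ell_attained[y' [y'w y'E <-]].
by rewrite -wlen_cat ell_le ?is_word_cat ?x'w // !eval_cat x'E y'E.
Qed.

Lemma ell_le_wlen w : is_word e w -> ell e wt w <= wlen wt w.
Proof. by move=> ww; exact: ell_le. Qed.

Lemma reduced_infix x y z : reduced_word e wt (x ++ y ++ z) -> reduced_word e wt y.
Proof.
move=> []; rewrite !is_word_cat => /and3P[xw yw zw]; rewrite !wlen_cat => lE.
split=> //; apply/eqP; rewrite eq_le ell_le_wlen // andbT.
have yzw : is_word e (y ++ z) by rewrite is_word_cat yw.
have := ell_cat xw yzw; have := ell_cat yw zw.
have := ell_le_wlen xw; have := ell_le_wlen zw; lra.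
Qed.
End WordLemmas.

(** * Representatives and productions *)

Section Productions.
Context (A : automaton) (e t : A).
Hypotheses (et : e != t) (out_t : forall x, out t x = ~~ x)
  (out_S : forall a x, a != t -> out a x = x)
  (sec_t : forall x, sec t x = e)
  (act_e : is_identity e).
Implicit Types (v w x y z b : seq A).

Local Notation parity := (t_parity t).
Local Notation strprod := (strprod e t).

(** [t] flips the first letter and has trivial sections; every other state fixes the first letter
    and defers to a section. *)
Lemma actK (a : A) : involutive (act a).
Proof.
move=> y; elim: y a => //= j y IH a; have [->|at_] := eqVneq a t.
  by rewrite !out_t !sec_t negbK !act_e.
by rewrite !out_S // IH.
Qed.

Lemma eval_cons w j (s : seq bool) :
  eval w (j :: s) = j (+) parity w :: eval (strprod (j (+) parity w) w) s.
Proof.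
(* Coordinates of the production are indexed by the output letter; rewriting in terms of it makes
   the recursion on [w] match that of [strprod]. *)
rewrite -{1}[j](addbK (parity w)); move: (j (+) _) => {}j.
elim: w j => [|a w IH] j /=; first by rewrite addbF.
rewrite /t_parity /= oddD -/(t_parity t w).
have [->|at_] := eqVneq a t.
  by rewrite addTb addbN -addNb IH /= out_t negbK sec_t act_e.
rewrite addFb IH /= out_S //; case: eqP => [->|_] //=.
by rewrite act_e.
Qed.

Lemma eval_inj_strprod v w : parity v = parity w ->
  (forall j, eval (strprod j v) = eval (strprod j w)) -> eval v = eval w.
Proof.
move=> pE sE; apply/funext => -[|j s]; last by rewrite !eval_cons pE sE.
have nil u : eval u [::] = [::] by elim: u => //= a u ->.
by rewrite !nil.
Qed.

Lemma eval_parity v w : eval v = eval w -> parity v = parity w.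
Proof.
by move=> vw; have := eval_cons v false [::]; rewrite vw eval_cons => -[].
Qed.

Lemma eval_strprod v w j :
  eval v = eval w -> eval (strprod j v) = eval (strprod j w).
Proof.
move=> vw; apply/funext => s; have := eval_cons v (j (+) parity v) s.
by rewrite vw eval_cons (eval_parity vw) addbK => -[].
Qed.

Context (R : realType) (wt : A -> R).
Hypothesis hwt : forall a : A, a != e -> 0 < wt a.
Context (rep : (seq bool -> seq bool) -> seq A).
Hypothesis hrep : minimal_reps e t wt rep.

Local Notation rmap_from := (rmap_from t rep).
Local Notation rmap := (rmap t rep).
Local Notation wlen := (wlen wt).

Lemma H_of_eval b : is_Sword e t b -> H_of e t (eval b).
Proof.
elim: b => [|a b IH] ; first by move=> _; exact: gen_one.
rewrite -cat1s is_Sword_cat => /andP[aS bS]; rewrite eval_cat.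
apply: gen_mul; last exact: IH.
apply: gen_mem; exists a => //.
by move: aS; rewrite /is_Sword !inE ![_ == a]eq_sym => /andP[].
Qed.

Lemma rep_Sword b : is_Sword e t b -> is_Sword e t (rep (eval b)).
Proof. by move=> /H_of_eval/hrep[]. Qed.

Lemma eval_rep b : is_Sword e t b -> eval (rep (eval b)) = eval b.
Proof. by move=> /H_of_eval/hrep[]. Qed.

Lemma wlen_rep b : is_Sword e t b -> wlen (rep (eval b)) <= wlen b.
Proof. by move=> bS; have [_ _] := hrep (H_of_eval bS); exact. Qed.

Lemma Sword_nil : is_Sword e t [::].
Proof. by []. Qed.

Lemma Sword_rcons b a : is_Sword e t b -> a != e -> a != t ->
  is_Sword e t (rcons b a).
Proof.
move=> bS ae at_; rewrite -cats1 is_Sword_cat bS /is_Sword !inE.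
by rewrite eq_sym ae eq_sym at_.
Qed.

Lemma rmap_from_cat_t b x z :
  rmap_from b (x ++ t :: z) = rmap_from b x ++ t :: rmap z.
Proof.
elim: x b => [|a x IH] b /=; first by rewrite eqxx.
by case: eqP => _; rewrite IH // -catA.
Qed.

Lemma rmap_cat_t x z : rmap (x ++ t :: z) = rmap x ++ t :: rmap z.
Proof. exact: rmap_from_cat_t. Qed.

Lemma rmap_from_Sword b x : t \notin x -> rmap_from b x = rep (eval (b ++ x)).
Proof.
elim: x b => [|a x IH] b; first by rewrite cats0.
rewrite inE negb_or eq_sym => /andP[/negPf /= -> tx].
by rewrite IH // cat_rcons.
Qed.

(* [b] is the part already read of the current block over S. *)
Lemma word_block_ind (P : seq A -> seq A -> Prop) :
  (forall b, is_Sword e t b -> P b [::]) ->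
  (forall b w, is_Sword e t b -> is_word e w -> P [::] w -> P b (t :: w)) ->
  (forall b a w, is_Sword e t b -> a != e -> a != t -> is_word e w ->
     P (rcons b a) w -> P b (a :: w)) ->
  forall w, is_word e w -> forall b, is_Sword e t b -> P b w.
Proof.
move=> H0 Ht HS; elim=> [|a w IH] ww b bS; first exact: H0.
move: ww; rewrite is_word_cons => /andP[ae ww].
have [->|at_] := eqVneq a t; first by apply: Ht => //; exact: IH.
by apply: HS => //; apply: IH => //; exact: Sword_rcons.
Qed.

Lemma rmap_from_cons_S b a w : a != t ->
  rmap_from b (a :: w) = rmap_from (rcons b a) w.
Proof. by move=> /negPf /= ->. Qed.

Lemma rmap_from_cons_t b w :
  rmap_from b (t :: w) = rep (eval b) ++ t :: rmap w.
Proof. by rewrite /= eqxx. Qed.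

Lemma rmap_from_word w : is_word e w ->
  forall b, is_Sword e t b -> is_word e (rmap_from b w).
Proof.
move: w; apply: word_block_ind => [b bS|b w bS ww IH|b a w bS ae at_ ww IH].
- exact/is_SwordW/rep_Sword.
- rewrite rmap_from_cons_t is_word_cat is_word_cons eq_sym et IH.
  by rewrite !andbT (is_SwordW (rep_Sword bS)).
- by rewrite rmap_from_cons_S.
Qed.

Lemma eval_rmap_from w : is_word e w ->
  forall b, is_Sword e t b -> eval (rmap_from b w) = eval (b ++ w).
Proof.
move: w; apply: word_block_ind => [b bS|b w bS ww IH|b a w bS ae at_ ww IH].
- by rewrite cats0 eval_rep.
- rewrite rmap_from_cons_t -[t :: rmap w]cat1s -[t :: w]cat1s !eval_cat IH.
  by rewrite eval_rep.
- by rewrite rmap_from_cons_S // IH cat_rcons.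
Qed.

Lemma rmap_word w : is_word e w -> is_word e (rmap w).
Proof. by move=> ww; exact: rmap_from_word. Qed.

Lemma eval_rmap w : is_word e w -> eval (rmap w) = eval w.
Proof. by move=> ww; rewrite [LHS]eval_rmap_from. Qed.

Lemma rmapK w : is_word e w -> rmap (rmap w) = rmap w.
Proof.
move=> ww; suff: forall b, is_Sword e t b ->
  rmap (rmap_from b w) = rmap_from b w by exact.
move: w ww; have rep_id b : is_Sword e t b -> rmap (rep (eval b)) = rep (eval b).
  move=> bS; rewrite /Defs.rmap rmap_from_Sword /= ?eval_rep //.
  by case/andP: (rep_Sword bS).
apply: word_block_ind => [b bS|b w bS ww IH|b a w bS ae at_ ww IH].
- exact: rep_id.
- by rewrite rmap_from_cons_t rmap_cat_t [X in X ++ _]rep_id // IH.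
- by rewrite rmap_from_cons_S.
Qed.

(** [rmap] rewrites only the blocks over S, so each [t] of [rmap w] comes from a [t] of [w], and the
    two sides are treated independently. *)
Lemma rmap_split_t w : is_word e w -> forall P Q, rmap w = P ++ t :: Q ->
  exists x y, [/\ w = x ++ t :: y, rmap x = P & rmap y = Q].
Proof.
move=> ww P Q; rewrite /Defs.rmap.
suff: forall b, is_Sword e t b -> forall P, rmap_from b w = P ++ t :: Q ->
  exists x y, [/\ w = x ++ t :: y, rmap_from b x = P & rmap y = Q] by exact.
have no_t b P' Q' : is_Sword e t b -> rep (eval b) <> P' ++ t :: Q'.
  move=> bS bE; case/andP: (rep_Sword bS) => _; rewrite bE.
  by rewrite mem_cat mem_head orbT.
clear P; move: w ww; apply: word_block_ind => [b bS|b w bS ww IH|b a w bS ae at_ ww IH] P.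
- by move=> /(no_t _ _ _ bS).
- rewrite rmap_from_cons_t => bE.
  (* The given [t] lies beyond the first block and its closing [t], is that closing [t], or lies
     inside the block; [no_t] excludes the last case. *)
  have := congr1 (take (size (rep (eval b)))) bE.
  have := congr1 (drop (size (rep (eval b)))) bE.
  rewrite drop_size_cat // take_size_cat // drop_cat take_cat.
  have [Plt|Pge] := ltnP (size (rep (eval b))) (size P).
    case Pd : (drop _ P) => [|a P'].
      by move: Plt; rewrite -subn_gt0 -size_drop Pd.
    move=> [ta wE] bP; have [x [y [xE yE zE]]] := IH _ wE.
    exists (t :: x), y; rewrite xE; split=> //.
    by rewrite rmap_from_cons_t bP [Defs.rmap _ _ x]yE ta -Pd cat_take_drop.
  case: (size _ - size P)%N => [|k]; rewrite /= ?cats0.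
    by move=> [<-] <-; exists [::], w.
  by move=> _ /(no_t _ _ _ bS).
- rewrite rmap_from_cons_S // => /IH[x [y [-> xE yE]]].
  by exists (a :: x), y; rewrite rmap_from_cons_S.
Qed.

Lemma wlen_rmap_from_cat b c w : is_Sword e t b -> is_word e w ->
  is_Sword e t c ->
  wlen (rmap_from (b ++ c) w) <= wlen (rep (eval b)) + wlen (rmap_from c w).
Proof.
move=> bS ww; move: w ww c.
have rep_cat c : is_Sword e t c -> wlen (rep (eval (b ++ c))) <=
    wlen (rep (eval b)) + wlen (rep (eval c)).
  move=> cS; have -> : eval (b ++ c) = eval (rep (eval b) ++ rep (eval c)).
    by rewrite !eval_cat !eval_rep.
  by rewrite -wlen_cat wlen_rep // is_Sword_cat !rep_Sword.
apply: word_block_ind => [c cS|c w cS ww _|c a w cS ae at_ ww IH].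
- exact: rep_cat.
- by rewrite !rmap_from_cons_t !wlen_cat addrA lerD2r rep_cat.
- by rewrite !rmap_from_cons_S // rcons_cat.
Qed.

(** Only the two blocks that meet at the junction merge, and the representative of their product is
    no longer than their two representatives together. *)
Lemma wlen_rmap_cat x y : is_word e x -> is_word e y ->
  wlen (rmap (x ++ y)) <= wlen (rmap x) + wlen (rmap y).
Proof.
move=> xw yw; suff: forall b, is_Sword e t b ->
  wlen (rmap_from b (x ++ y)) <= wlen (rmap_from b x) + wlen (rmap y) by exact.
move: x xw.
apply: word_block_ind => [b bS|b w bS ww IH|b a w bS ae at_ ww IH].
- by have := @wlen_rmap_from_cat b [::] _ bS yw isT; rewrite cats0.
- by rewrite cat_cons !rmap_from_cons_t !wlen_cat !wlen_cons -!addrA !lerD2l.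
- by rewrite cat_cons !rmap_from_cons_S.
Qed.

Hypothesis hadm : admissible e t wt rep.

(** Admissibility costs one [wt t] per block, empty blocks included. There is one block more than
    there are letters [t], and these letters disappear from the productions, so all costs but one
    are paid for. *)
Lemma wlen_production_le w : is_word e w ->
  \sum_(j : bool) wlen (production e t rep j (rmap w)) <= wlen w + wt t.
Proof.
move=> ww; suff /(_ _ Sword_nil) : forall b, is_Sword e t b ->
    \sum_j wlen (production e t rep j (rmap_from b w)) <=
    wlen b + wlen w + wt t by rewrite wlen_nil add0r.
move: w ww.
have block b : is_Sword e t b ->
    \sum_j wlen (production e t rep j (rep (eval b))) <= wlen b + wt t.
  move=> bS; have /hadm : T_of e t rep (rep (eval b)).
    by exists (eval b) => //; exact: H_of_eval.
  by rewrite big_bool /=; have := wlen_rep bS; lra.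
apply: word_block_ind => [b bS|b w bS ww IH|b a w bS ae at_ ww IH].
- by rewrite wlen_nil addr0 block.
- rewrite rmap_from_cons_t.
  (* The separating [t] swaps the coordinates of what follows; the sum over both coordinates does
     not notice. *)
  have /= le j : wlen (production e t rep j (rep (eval b) ++ t :: rmap w)) <=
    wlen (production e t rep j (rep (eval b))) +
    wlen (production e t rep (~~ j) (rmap w)).
    rewrite /production strprod_cat (parity_Sword (rep_Sword bS)) /= addbF eqxx.
    by rewrite wlen_rmap_cat // strprod_word.
  apply: le_trans (ler_sum _ (fun j _ => le j)) _; rewrite big_split /=.
  have := block _ bS; move: IH; rewrite !big_bool wlen_cons wlen_nil /=.
  by lra.
- rewrite rmap_from_cons_S //; apply: (le_trans IH).
  by rewrite -cats1 wlen_cat !wlen_cons wlen_nil; lra.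
Qed.
End Productions.

(** * Good words shorten productions *)

(** Occurrences are picked from left to right, each in what remains after the previous one; [k] is a
    lower bound for their number. *)
Fixpoint disjoint_occurrences (T : Type) (u : seq T) (k : nat) (w : seq T) : Prop :=
  if k is k'.+1 then
    exists x y, w = x ++ u ++ y /\ disjoint_occurrences u k' y
  else True.

Lemma disjoint_occurrences_catl (T : Type) (u x w : seq T) k :
  disjoint_occurrences u k w -> disjoint_occurrences u k (x ++ w).
Proof.
case: k => //= k [y [z [-> zk]]]; exists (x ++ y), z.
by rewrite -catA.
Qed.

Section Gain.
Context (A : automaton) (e t : A).
Hypotheses (et : e != t) (out_t : forall x, out t x = ~~ x)
  (out_S : forall a x, a != t -> out a x = x)
  (sec_t : forall x, sec t x = e)
  (act_e : is_identity e).
Implicit Types (v w x y z b : seq A).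
Context (R : realType) (wt : A -> R).
Hypothesis hwt : forall a : A, a != e -> 0 < wt a.
Context (rep : (seq bool -> seq bool) -> seq A).
Hypothesis hrep : minimal_reps e t wt rep.
Hypothesis hadm : admissible e t wt rep.

Local Notation parity := (t_parity t).
Local Notation strprod := (strprod e t).
Local Notation rmap := (rmap t rep).
Local Notation wlen := (wlen wt).
Local Notation ell := (ell e wt).
Local Notation production := (production e t rep).

(** String productions without [r] suffice here, since [ell] depends only on the group element. *)
Fixpoint level_ell k w : R :=
  if k is k'.+1 then \sum_(j : bool) level_ell k' (strprod j w) else ell w.

Lemma eq_level_ell k v w : eval v = eval w -> level_ell k v = level_ell k w.
Proof.
elim: k v w => [|k IH] v w vw /=; first exact: eq_ell.
by apply: eq_bigr => j _; apply: IH; exact: eval_strprod.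
Qed.

Lemma level_ell_production k w : is_word e w ->
  level_ell k.+1 w = \sum_(j : bool) level_ell k (production j (rmap w)).
Proof.
move=> ww; rewrite -(eq_level_ell _ (eval_rmap hrep ww)) /=.
apply: eq_bigr => j _; apply: eq_level_ell; rewrite (eval_rmap hrep) //.
exact: strprod_word.
Qed.

Local Notation defect k := ((2 ^+ k - 1) * wt t).

(** Splitting a vertex costs at most [wt t], and this happens at every vertex above the level, so
    the defects satisfy d(k+1) = 2 d(k) + [wt t]. *)
Lemma level_ell_le k w : is_word e w -> level_ell k w <= ell w + defect k.
Proof.
elim: k w => [|k IH] w ww; first by rewrite expr0 subrr mul0r addr0.
have [v [vw vE <-]] := ell_attained hwt ww.
rewrite -(eq_level_ell _ vE) level_ell_production //.
have le j : level_ell k (production j (rmap v)) <=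
    wlen (production j (rmap v)) + defect k.
  have pw : is_word e (production j (rmap v)).
    by rewrite (rmap_word et hrep) ?strprod_word.
  by apply: le_trans (IH _ pw) _; rewrite lerD2r ell_le_wlen.
apply: le_trans (ler_sum _ (fun j _ => le j)) _.
rewrite big_split /= sumr_const card_bool -mulr_natl.
have := wlen_production_le hrep hadm vw; rewrite exprS; lra.
Qed.

Lemma level_ell1_cat x y :
  level_ell 1 (x ++ y) <= level_ell 1 x + level_ell 1 y.
Proof.
rewrite /= !big_bool /= !strprod_cat.
have := ell_cat hwt (strprod_word e t true x)
  (strprod_word e t (true (+) parity x) y).
have := ell_cat hwt (strprod_word e t false x)
  (strprod_word e t (false (+) parity x) y).
by case: (t_parity t x) => /=; lra.
Qed.

Lemma level_ell1_cons_t w : level_ell 1 (t :: w) = level_ell 1 w.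
Proof. by rewrite /= !big_bool /= eqxx addrC. Qed.

Lemma level_ell1_cons_t_le w : is_word e w ->
  level_ell 1 (t :: w) <= wlen (t :: w).
Proof.
move=> ww; rewrite level_ell1_cons_t wlen_cons.
by have := level_ell_le 1 ww; have := ell_le_wlen hwt ww; lra.
Qed.

Lemma ell_production j w : ell (production j w) = ell (strprod j w).
Proof. by apply: eq_ell; rewrite (eval_rmap hrep) ?strprod_word. Qed.

Lemma ntblocks_le w : (ntblocks e t w <= count_mem t w)%N.
Proof.
rewrite /ntblocks; elim: w e => //= a w IH a'.
by apply: leq_add => //; case: (a == t); rewrite ?andbF ?leq_b1.
Qed.

Lemma starlen_le w : is_word e w -> starlen e t wt w <= wlen w.
Proof.
move=> ww; have t1 : ell [:: t] <= wt t.
  by have := @ell_le_wlen _ _ _ _ hwt [:: t]; rewrite wlen_cons wlen_nil addr0;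
     apply; rewrite /is_word inE.
have t0 : 0 <= wt t by rewrite ltW // hwt // eq_sym.
apply: (@le_trans _ _ (wt t * (count_mem t w)%:R + wlen [seq a <- w | a != t])).
  rewrite lerD2r (@le_trans _ _ (wt t * (ntblocks e t w)%:R)) ?ler_wpM2r //.
  by rewrite ler_wpM2l // ler_nat ntblocks_le.
rewrite /Defs.wlen [leRHS](bigID (pred1 t)) /= -[X in _ + X <= _]big_filter.
rewrite !big_filter lerD2r (eq_bigr (fun=> wt t)); last by move=> a /eqP ->.
by rewrite big_const_seq iter_addr_0 mulr_natr.
Qed.

(** The word is cut around the reducing subwords [v]. As [v] begins with [t] and is followed by [t],
    every piece begins with [t], and this letter pays for the defect of its piece. Each [v] itself
    saves [eps], because its starred length is at most its length. *)
Lemma good0_gain u : good e t wt rep 0 u -> exists2 eps : R, 0 < eps &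
  forall k w, is_word e w -> disjoint_occurrences u k w ->
    level_ell 1 w <= wlen w + wt t - eps * k%:R.
Proof.
move=> [v [wr [x [y uE]] _ gain]].
have uw : is_word e u.
  by case: wr => v0 v0w ->; exact: (rmap_word et hrep).
have [xw vw _ yw] : [/\ is_word e x, is_word e v, t != e & is_word e y].
  by apply/and4P; rewrite -is_word_cons -!is_word_cat -uE.
exists (starlen e t wt v - (ell (production false v) + ell (production true v))).
  by rewrite subr_gt0.
set eps := (X in forall k w, _ -> _ -> _ <= _ - X * _).
(* Prepending [t] leaves the level-1 length unchanged and makes the first piece begin with [t] too;
   this is the single [wt t] in the bound. *)
suff cons_t k z : is_word e z -> disjoint_occurrences u k z ->
    level_ell 1 (t :: z) <= wlen (t :: z) - eps * k%:R.
  move=> k w ww occ; rewrite -level_ell1_cons_t.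
  by have := cons_t _ _ ww occ; rewrite wlen_cons; lra.
elim: k z => [|k IH] z zw.
  by move=> _; rewrite mulr0 subr0 level_ell1_cons_t_le.
move=> [z1 [z2 [zE occ]]].
move: zw; rewrite zE !is_word_cat => /and3P[z1w _ z2w].
have -> : t :: (z1 ++ u ++ z2) = (t :: (z1 ++ x)) ++ v ++ (t :: (y ++ z2)).
  by rewrite uE /= -!catA.
apply: le_trans (level_ell1_cat _ _) _.
have := level_ell1_cat v (t :: (y ++ z2)).
have : is_word e (z1 ++ x) by rewrite is_word_cat z1w.
move=> /level_ell1_cons_t_le.
have : level_ell 1 v <= wlen v - eps.
  rewrite /eps /= big_bool /= !ell_production.
  by have := starlen_le vw; lra.
have : is_word e (y ++ z2) by rewrite is_word_cat yw.
move=> /IH/(_ (disjoint_occurrences_catl _ occ)).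
by rewrite !wlen_cat -natr1 mulrDr mulr1 -[eps]/eps; lra.
Qed.

(** What lies between two letters [t] of a word in weak reduced form is itself an image of [r],
    hence fixed by it. The letter from S forces the two end letters [t] to be distinct
    occurrences. *)
Lemma protected_subwordP v u : protected_subword e t rep v u ->
  exists x a y, [/\ v = t :: rcons a t, u = x ++ v ++ y, is_word e u &
                    rmap a = a].
Proof.
move=> [[v0 v0w uE] /infixP[x [y uxy]] [v1 vt] [v2 vr] hasS].
have uw : is_word e u by rewrite uE (rmap_word et hrep).
case: v2 => [|t' a] in vr.
  by move: hasS; rewrite vr /= eqxx andbF.
have tE : t' = t by move: vr; rewrite vt => -[].
rewrite tE {t' tE} in vr.
exists x, a, y; split=> //.
have : rmap v0 = x ++ t :: (a ++ t :: y).
  by rewrite -uE uxy vr /= cat_rcons.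
move=> /(rmap_split_t hrep v0w)[z1 [z2 [v0E _]]].
have z2w : is_word e z2.
  by move: v0w; rewrite v0E is_word_cat is_word_cons => /and3P[].
move=> /(rmap_split_t hrep z2w)[z3 [z4 [z2E <- _]]].
apply: (rmapK hrep).
by move: z2w; rewrite z2E is_word_cat => /andP[].
Qed.

(** The prefix [z] can only affect blocks before the first [t] of [y], and every occurrence begins
    with a [t]. *)
Lemma disjoint_occurrences_rmap_catl r z y k : is_word e y ->
  disjoint_occurrences (t :: r) k (rmap y) ->
  disjoint_occurrences (t :: r) k (rmap (z ++ y)).
Proof.
move=> yw; case: k => //= k [x1 [x2 [yE occ]]].
have [y1 [y2 [-> _ y2E]]] := rmap_split_t hrep yw yE.
exists (rmap (z ++ y1)), x2; split => //.
by rewrite catA rmap_cat_t y2E.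
Qed.

Lemma disjoint_occurrences_rmap_insert a x z y k P Q :
  is_word e z -> is_word e y -> rmap z = P ++ (t :: rcons a t) ++ Q ->
  disjoint_occurrences (t :: rcons a t) k (rmap y) ->
  disjoint_occurrences (t :: rcons a t) k.+1 (rmap (x ++ z ++ y)).
Proof.
move=> zw yw; rewrite /= cat_rcons => /(rmap_split_t hrep zw).
move=> [z1 [z2 [zE _ z2E]]] occ.
have z2w : is_word e z2.
  by move: zw; rewrite zE is_word_cat is_word_cons => /and3P[].
have [z3 [z4 [z2E' z3E _]]] := rmap_split_t hrep z2w z2E.
exists (rmap (x ++ z1)), (rmap (z4 ++ y)); split.
  by rewrite zE z2E' -!catA /= catA rmap_cat_t -catA rmap_cat_t z3E cat_rcons.
exact: disjoint_occurrences_rmap_catl.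
Qed.

(** The end letters [t] shield [v] from [r], so its production appears intact, up to merging at its
    ends. There [u'] survives because it also begins and ends with [t]. Each occurrence of [u] thus
    yields one of [u'] in one of the two coordinates. *)
Lemma disjoint_occurrences_production u u' k w : preceq e t rep u' u ->
  is_word e w -> disjoint_occurrences u k w ->
  exists kj : bool -> nat, k = (\sum_j kj j)%N /\
    forall j, disjoint_occurrences u' (kj j) (production j (rmap w)).
Proof.
move=> [v [/protected_subwordP[x [a [y [vE uE uw aE]]]] [j0 hu']]].
have [x' [a' [y' [u'E pE _ _]]]] := protected_subwordP hu'.
elim: k w => [|k IH] w ww; first by exists (fun=> 0%N); rewrite big_bool.
move=> /= [x0 [y0 [wE occ]]].
have [x0w /andP[_ y0w]] : is_word e x0 /\ is_word e u && is_word e y0.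
  by move: ww; rewrite wE !is_word_cat => /andP[].
have yw : is_word e y by move: uw; rewrite uE !is_word_cat => /and3P[].
have yy0w : is_word e (y ++ y0) by rewrite is_word_cat yw.
(* The tail [y] of this copy of [u] is handed over to the rest, which then starts right after
   [v]. *)
have [kj [-> occj]] := IH _ yy0w (disjoint_occurrences_catl _ occ).
pose X := rmap (x0 ++ x); pose W := rmap (y ++ y0).
have rwE : rmap w = X ++ v ++ W.
  rewrite wE uE vE -!catA /= catA rmap_cat_t cat_rcons rmap_cat_t aE.
  by rewrite cat_rcons.
pose s := parity X (+) parity v.
(* The new copy sits in coordinate [j0], swapped if the prefix is odd; everything after [v] is
   shifted by the parity [s] of prefix and [v]. *)
exists (fun j => (j == j0 (+) parity X) + kj (j (+) s))%N; split.
  by rewrite !big_bool /= -/s; case: s (j0 (+) _) => [] []/=; lia.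
move=> j; rewrite /Defs.production rwE !strprod_cat -addbA -/s.
have := occj (j (+) s); rewrite /Defs.production -/W u'E.
case: eqP => [->|_] occs.
  rewrite addbK add1n.
  apply: (disjoint_occurrences_rmap_insert _ _ _ _ occs); rewrite ?strprod_word //.
  by rewrite [LHS]pE u'E.
rewrite add0n catA.
by apply: disjoint_occurrences_rmap_catl; rewrite ?strprod_word.
Qed.

(** Occurrences are passed down [m] levels, spread over the vertices, and then each saves [eps]. The
    remaining levels only add the usual defect. *)
Lemma good_gain m u : good e t wt rep m u -> exists2 eps : R, 0 < eps &
  forall D k w, (m < D)%N -> is_word e w -> disjoint_occurrences u k w ->
    level_ell D w <= wlen w + defect D - eps * k%:R.
Proof.
elim: m u => [|m IH] u.
  move=> /good0_gain[eps eps0 gain]; exists eps => // -[//|D] k w _ ww occ.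
  have le j : level_ell D (strprod j w) <= ell (strprod j w) + defect D.
    by rewrite level_ell_le ?strprod_word.
  apply: le_trans (ler_sum _ (fun j _ => le j)) _.
  rewrite big_split /= sumr_const card_bool -mulr_natl exprS.
  by have /= := gain _ _ ww occ; lra.
move=> [u' uu' /IH[eps eps0 gain]]; exists eps => // -[//|D] k w mD ww occ.
have [kj [-> occj]] := disjoint_occurrences_production uu' ww occ.
rewrite level_ell_production //.
have le j : level_ell D (production j (rmap w)) <=
    wlen (production j (rmap w)) + defect D - eps * (kj j)%:R.
  by apply: gain => //; rewrite (rmap_word et hrep) ?strprod_word.
apply: le_trans (ler_sum _ (fun j _ => le j)) _.
have := wlen_production_le hrep hadm ww.
by rewrite !big_bool /= natrD exprS; lra.
Qed.
End Gain.

(** * Normal forms and bad words *)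

Section NormalForms.
Context (A : automaton) (e t : A).
Implicit Types (v w x y z b : seq A).
Context (R : realType) (wt : A -> R).
Hypothesis hwt : forall a : A, a != e -> 0 < wt a.
Local Notation wlen := (wlen wt).

(** The choice depends only on [eval w], so sums over group elements become sums over normal
    words. *)
Definition normal_form w : seq A :=
  xget [::] [set v | reduced_word e wt v /\ eval v = eval w].

Definition is_normal w : Prop := is_word e w /\ normal_form w = w.

Lemma normal_formP w : is_word e w ->
  reduced_word e wt (normal_form w) /\ eval (normal_form w) = eval w.
Proof.
move=> ww; apply: (@xgetPex _ _ [set v | reduced_word e wt v /\ eval v = eval w]).
have [v [vw vE vl]] := ell_attained hwt ww.
by exists v; split => //; split => //; rewrite vl (eq_ell e wt vE).
Qed.

Lemma eq_normal_form v w : eval v = eval w -> normal_form v = normal_form w.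
Proof. by rewrite /normal_form => ->. Qed.

Lemma is_normal_form w : is_word e w -> is_normal (normal_form w).
Proof.
by move=> /normal_formP[[nw _] nE]; split => //; exact: eq_normal_form.
Qed.

Lemma is_normal_reduced w : is_normal w -> reduced_word e wt w.
Proof. by move=> [/normal_formP[nw _] nE]; rewrite nE in nw. Qed.

Lemma is_normal_inj v w : is_normal v -> is_normal w -> eval v = eval w -> v = w.
Proof. by move=> [_ vE] [_ wE] /eq_normal_form; rewrite vE wE. Qed.

Lemma expR_wlen s w : expR (s * wlen w) = \prod_(a <- w) expR (s * wt a).
Proof. by rewrite /Defs.wlen mulr_sumr expR_sum. Qed.

Definition growth_bound (s : R) : Prop :=
  exists Z, sum_bounded is_normal (fun w => expR (- s * wlen w)) Z.

Lemma growth_bound_large : exists2 s, 0 < s & growth_bound s.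
Proof.
have [c c0 cP] := wt_min hwt.
pose N : R := #|A|%:R; have N0 : 0 <= N by exact: ler0n.
(* The sum over all words is geometric with ratio at most N exp(-s c). With s c = 2 N + 1 this is
   below 1, as exp x is at least 1 + x. *)
exists ((2 * N + 1) / c); first by rewrite divr_gt0 // ltr_wpDl // mulr_ge0.
set s := _ / c; have s0 : 0 <= s by rewrite divr_ge0 ?ltW // ltr_wpDl // mulr_ge0.
have bA : sum_bounded (fun a : A => a != e) (fun a => expR (- s * wt a))
    (\sum_(a : A) expR (- s * c)).
  apply: (@sum_bounded_le _ _ _ (fun=> True) _ (fun=> expR (- s * c))).
    by move=> a ae; rewrite ler_expR !mulNr lerN2 ler_wpM2l ?cP.
  by apply: sum_bounded_fin => a; exact: expR_ge0.
have Z1 : \sum_(a : A) expR (- s * c) < 1.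
  rewrite sumr_const -mulr_natl -/N mulNr expRN divfK ?gt_eqF //.
  rewrite -/(N / expR (2 * N + 1)) ltr_pdivrMr ?expR_gt0 // mul1r.
  by apply: lt_le_trans (expR_ge1Dx _); lra.
have bW := sum_bounded_seq (fun a => expR_ge0 _) Z1 bA.
exists (1 - \sum_(a : A) expR (- s * c))^-1.
apply: sum_bounded_le bW => w [ww _]; rewrite expR_wlen; split=> // a aw.
by apply: contraNneq ww => <-.
Qed.

Definition content w := [seq count_mem a w | a <- enum A].

Lemma content_inj v w : content v = content w -> perm_eq v w.
Proof.
move=> /eq_in_map vw; apply/allP => a _ /=.
by apply/eqP; apply: vw; rewrite mem_enum.
Qed.

Lemma size_content w : size (content w) = #|A|.
Proof. by rewrite size_map -cardE. Qed.

Lemma prod_content (q : R) w : \prod_(k <- content w) q ^+ k = q ^+ size w.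
Proof.
rewrite big_map prodrXr; congr (_ ^+ _); rewrite big_enum /=.
elim: w => [|a w IH] /=; first by rewrite big1.
rewrite big_split /= IH (bigD1 a) //= eqxx big1 //.
by move=> b /negPf; rewrite eq_sym => ->.
Qed.

(** Letter counts determine the length, and a length is shared by at most [M] bad words. So counts
    and an index determine a bad word, and the counts contribute a product of [#|A|] geometric
    series. *)
Lemma sum_bounded_bad (U : set (seq A)) (M : nat) (s : R) : 0 < s ->
  (forall L : R, 0 < L ->
    ([set w | bad_word e wt U w /\ ell e wt w = L] #<= `I_M)%card) ->
  exists Z, sum_bounded (bad_word e wt U) (fun b => expR (- s * wlen b)) Z.
Proof.
move=> s0 bad; have [c c0 cP] := wt_min hwt.
pose q := expR (- s * c).
have q01 : 0 <= q < 1.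
  by rewrite expR_ge0 /= -expR0 ltr_expR mulNr oppr_lt0 mulr_gt0.
have /choice[f fP] : forall L : R, exists f : seq A -> nat, 0 < L ->
    (forall w, bad_word e wt U w -> ell e wt w = L -> (f w < M)%N) /\
    {in [set w | bad_word e wt U w /\ ell e wt w = L] &, injective f}.
  move=> L; have [L0|_] := boolP (0 < L); last by exists (fun=> 0%N).
  have /pcard_leP[f] := bad _ L0; exists f => _; split; last exact: inj.
  by move=> w wb wL; apply: (@funS _ _ _ _ f w).
(* The bound [M] concerns positive lengths only. The empty word gets index 0 and is told apart by
   its counts. *)
pose idx w := if w is [::] then 0%N else f (ell e wt w) w.
exists ((1 - q)^-1 ^+ #|A| * (\sum_(i < M.+1) 1)).
have bC := @sum_bounded_seqk R nat _ _ _ #|A|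
  (fun i => exprn_ge0 i (andP q01).1) (sum_bounded_geometric q01).
have bM := @sum_bounded_fin R 'I_M.+1 (fun=> 1) (fun=> ler01).
have C0 (k : seq nat) : 0 <= \prod_(i <- k) q ^+ i.
  by apply: prodr_ge0 => i _; rewrite exprn_ge0 //; case/andP: q01.
have := sum_bounded_prod C0 bC bM.
have ell_gt0 w : reduced_word e wt w -> w <> [::] -> 0 < ell e wt w.
  case: w => // a w [aw <-] _; move: aw; rewrite is_word_cons => /andP[ae ww].
  by rewrite wlen_cons ltr_wpDr ?hwt // (wlen_ge0 hwt).
have idxK b : bad_word e wt U b -> nat_of_ord (inord (idx b) : 'I_M.+1) = idx b.
  move=> bb; rewrite inordK // ltnS; case: b bb => // a b bb.
  by apply/ltnW/(fP _ (ell_gt0 _ bb.1 _)).1.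
apply: (@sum_bounded_inj _ _ _ (fun w => (content w, inord (idx w)))).
  move=> x y xb yb [/content_inj xy xyM].
  have idxE : idx x = idx y by rewrite -[LHS]idxK // -[RHS]idxK // xyM.
  have [x0|/eqP x0] := eqVneq x [::].
    by apply/esym; rewrite x0; apply/nilP; rewrite /nilp -(perm_size xy) x0.
  have y0 : y <> [::] by move=> y0; apply: x0; apply/nilP; rewrite /nilp (perm_size xy) y0.
  have xyL : ell e wt x = ell e wt y.
    by rewrite -xb.1.2 -yb.1.2; exact: perm_big.
  have [_ inj] := fP _ (ell_gt0 _ xb.1 x0).
  apply: inj; rewrite ?inE //.
  by move: idxE; rewrite /idx -xyL; case: (x) x0 => // ? ? _; case: (y) y0.
move=> b bb; split; first by split => //; split; [exact: size_content|].
rewrite mulr1 prod_content -expRM_natr ler_expR !mulNr lerN2 -mulrA.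
by rewrite ler_pM2l // (wlen_ge_size cP bb.1.1).
Qed.

Context (n : nat) (u : 'I_n -> seq A).
Hypotheses (u_neq_nil : forall i, u i <> [::])
  (u_word : forall i, is_word e (u i)).
Local Notation bad := (bad_word e wt (range u)).

Definition assemble (b : seq A) (l : seq ('I_n * seq A)) : seq A :=
  b ++ flatten [seq u p.1 ++ p.2 | p <- l].

(** Cut at any occurrence of some [u i] and recurse on both sides, which are shorter because [u i]
    is nonempty and reduced because factors of reduced words are. *)
Lemma bad_decomposition w : reduced_word e wt w ->
  exists b l, [/\ bad b, forall p, p \in l -> bad p.2 & w = assemble b l].
Proof.
have [k] := ubnP (size w); elim: k w => // k IH w wk wr.
have [[i /infixP[x [y wE]]]|no_u] := pselect (exists i, infix (u i) w); last first.
  exists w, [::]; split => //; last by rewrite /assemble cats0.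
  by split => // _ [i _ <-]; apply/negP => iw; apply: no_u; exists i.
have ui : (0 < size (u i))%N by case: (u i) (@u_neq_nil i).
have xr : reduced_word e wt x.
  by apply: (@reduced_infix _ _ _ _ hwt [::] x (u i ++ y)); rewrite -wE.
have yr : reduced_word e wt y.
  by apply: (@reduced_infix _ _ _ _ hwt (x ++ u i) y [::]); rewrite cats0 -catA -wE.
move: wk; rewrite wE !size_cat => wk.
have [|b [l [bb bl ->]]] := IH x _ xr; first by lia.
have [|b' [l' [bb' bl' ->]]] := IH y _ yr; first by lia.
exists b, (l ++ (i, b') :: l'); split => //.
  by move=> p; rewrite mem_cat inE => /or3P[/bl|/eqP ->|/bl'].
by rewrite /assemble map_cat flatten_cat /= -!catA.
Qed.

Lemma assemble_occurrences b l i :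
  disjoint_occurrences (u i) (count (fun p => p.1 == i) l) (assemble b l).
Proof.
elim: l b => //= -[j b'] l IH b.
rewrite /assemble /= -catA; have := IH b'; rewrite -/(assemble b' l).
have [->|_] := eqVneq j i; last by move=> /disjoint_occurrences_catl; rewrite catA.
by move=> occ; exists b, (assemble b' l).
Qed.

(** A factor [rho] per cut makes the series over lists of pairs (index, bad word) converge. Dropping
    the lengths of the [u i] only enlarges the terms. *)
Lemma sum_bounded_assemble (M : nat) (s : R) : 0 < s ->
  (forall L : R, 0 < L -> ([set w | bad w /\ ell e wt w = L] #<= `I_M)%card) ->
  exists rho : R, [/\ 0 < rho, rho < 1 & exists Z,
    forall d : seq A -> seq A * seq ('I_n * seq A),
    (forall w, reduced_word e wt w -> [/\ bad (d w).1,
        forall p, p \in (d w).2 -> bad p.2 & w = assemble (d w).1 (d w).2]) ->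
    sum_bounded (reduced_word e wt)
      (fun w => expR (- s * wlen w) * rho ^+ size (d w).2) Z].
Proof.
move=> s0 hbad; have [Z bZ] := sum_bounded_bad s0 hbad.
have Z0 := sum_bounded_ge0 bZ.
have nZ0 : 0 <= n%:R * Z by rewrite mulr_ge0.
(* This choice gives both [rho < 1] and n rho Z < 1, the ratio of the series over lists. *)
pose D := 2 + n%:R * Z; have D0 : 0 < D by rewrite /D; lra.
pose rho := D^-1; have rho0 : 0 < rho by rewrite invr_gt0.
exists rho; split => //; first by rewrite invf_lt1 // /D; lra.
have bI : sum_bounded (fun=> True) (fun _ : 'I_n => rho) (\sum_(i < n) rho).
  by apply: sum_bounded_fin => _; exact: ltW.
have bIZ := sum_bounded_prod (fun=> ltW rho0) bI bZ.
have z1 : (\sum_(i < n) rho) * Z < 1.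
  rewrite sumr_const card_ord -mulr_natl mulrAC /rho ltr_pdivrMr // /D.
  by lra.
have f0 (p : 'I_n * seq A) : 0 <= rho * expR (- s * wlen p.2).
  by rewrite mulr_ge0 ?expR_ge0 ?ltW.
have bL := sum_bounded_seq f0 z1 bIZ.
have bBL := sum_bounded_prod (fun w => expR_ge0 (- s * wlen w)) bZ bL.
eexists => d dP; apply: sum_bounded_inj bBL; first last.
- move=> w wr; have [b0 bl wE] := dP _ wr; split.
    split; [exact: b0 | by move=> p /bl].
  rewrite {1}wE big_split /= mulrC.
  rewrite [X in X * _ <= _](_ : _ = \prod_(p <- (d w).2) rho); last first.
    by rewrite big_const_seq count_predT iter_mulr_1.
  rewrite [leRHS]mulrCA ler_pM2l; last by rewrite prodr_gt0.
  rewrite -expR_sum -expRD ler_expR -mulr_sumr -mulrDr !mulNr lerN2.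
  rewrite ler_pM2l // /assemble wlen_cat lerD2l.
  elim: (d w).2 => [|p l IH]; first by rewrite big_nil wlen_nil.
  rewrite big_cons /= !wlen_cat; have := wlen_ge0 hwt (u_word p.1); lra.
- move=> x y xr yr dxy; have [_ _ ->] := dP _ xr.
  by have [_ _ ->] := dP _ yr; rewrite dxy.
Qed.
End NormalForms.

(** * Convergence of the growth series *)

Section Growth.
Context (A : automaton) (e t : A).
Hypotheses (et : e != t) (out_t : forall x, out t x = ~~ x)
  (out_S : forall a x, a != t -> out a x = x)
  (sec_t : forall x, sec t x = e) (act_e : is_identity e).
Implicit Types (v w x y z b : seq A).
Context (R : realType) (wt : A -> R).
Hypothesis hwt : forall a : A, a != e -> 0 < wt a.

Local Notation wlen := (wlen wt).
Local Notation growth_bound := (growth_bound e wt).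
Local Notation is_normal := (is_normal e wt).
Local Notation level_ell := (level_ell e t wt).

(** An element is determined by its parity and its two sections, and level lengths of sections add
    up. A bound [Z] at level [D] thus gives twice its square at the next level. *)
Lemma sum_bounded_level_ell s : growth_bound s ->
  forall D, exists Z, sum_bounded is_normal (fun w => expR (- s * level_ell D w)) Z.
Proof.
move=> gs; elim=> [|D [Z bZ]].
  have [Z bZ] := gs; exists Z; apply: sum_bounded_le bZ => w nw; split => //=.
  by have [_ ->] := is_normal_reduced hwt nw.
have bB := @sum_bounded_fin R bool (fun=> 1) (fun=> ler01).
have f0 w : 0 <= expR (- s * level_ell D w) by exact: expR_ge0.
have bZZ := sum_bounded_prod f0 bZ bZ.
eexists; pose nf j w := normal_form e wt (strprod e t j w).
apply: (@sum_bounded_inj _ _ _ (fun w => (t_parity t w, (nf false w, nf true w))));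
  last exact: (sum_bounded_prod (fun=> ler01) bB bZZ).
  move=> x y nx ny [pE fE tE]; have := is_normal_inj nx ny; apply.
  apply: (eval_inj_strprod out_t out_S sec_t act_e pE) => j.
  have nfE w : eval (nf j w) = eval (strprod e t j w).
    by have [] := normal_formP hwt (strprod_word e t j w).
  by rewrite -!nfE; case: (j); rewrite ?fE ?tE.
move=> w _; split.
  by split => //; split; apply: is_normal_form => //; exact: strprod_word.
rewrite mul1r -expRD -mulrDr /= big_bool /= addrC.
have nfE j : level_ell D (nf j w) = level_ell D (strprod e t j w).
  apply: (eq_level_ell out_t out_S sec_t act_e).
  by have [] := normal_formP hwt (strprod_word e t j w).
by rewrite !nfE.
Qed.

Context (rep : (seq bool -> seq bool) -> seq A).
Hypothesis hrep : minimal_reps e t wt rep.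
Hypothesis hadm : admissible e t wt rep.
Context (n : nat) (u : 'I_n -> seq A) (m : 'I_n -> nat).
Hypothesis hgood : forall i, good e t wt rep (m i) (u i).

Lemma good_word k v : good e t wt rep k v -> is_word e v /\ v <> [::].
Proof.
case: k => [[v' [[v0 v0w vE] [x [y vxy]] _ _]]|k [v' [v'' [pv _]] _]].
  split; first by rewrite vE (rmap_word et hrep).
  by rewrite vxy => /(congr1 size); rewrite !size_cat /=; lia.
have [x [a [y [-> -> ? _]]]] := protected_subwordP et hrep pv.
by split => // /(congr1 size); rewrite !size_cat /=; lia.
Qed.

Lemma sum_count_fst (l : seq ('I_n * seq A)) :
  (\sum_i count (fun p => p.1 == i) l)%N = size l.
Proof.
elim: l => [|p l IH] /=; first by rewrite big1.
rewrite big_split /= IH (bigD1 p.1) //= eqxx big1 //.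
by move=> i /negPf; rewrite eq_sym => ->.
Qed.

Lemma assemble_gain : exists (D : nat) (c eps : R), 0 < eps /\
  forall w b l, is_word e w -> w = assemble u b l ->
    level_ell D w <= wlen w + c - eps * (size l)%:R.
Proof.
have /choice[eps0 gain0] : forall i, exists eps : R, 0 < eps /\
    forall D k w, (m i < D)%N -> is_word e w -> disjoint_occurrences (u i) k w ->
    level_ell D w <= wlen w + (2 ^+ D - 1) * wt t - eps * k%:R.
  move=> i; have [eps eps0 gain] :=
    good_gain et out_t out_S sec_t act_e hwt hrep hadm (hgood i).
  by exists eps.
pose eps := \big[Num.min/1]_i eps0 i.
have eps_gt0 : 0 < eps by apply: lt_bigmin => // i _; case: (gain0 i).
have [D mD] : exists D, forall i, (m i < D)%N.
  by exists (\max_i m i).+1 => i; rewrite ltnS leq_bigmax.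
(* The estimates for the [n] indices are averaged together with the gainless estimate [base], so the
   divisor is nonzero even when [n] is 0. *)
exists D, ((2 ^+ D - 1) * wt t), (eps / n.+1%:R); split.
  by rewrite divr_gt0 // ltr0n.
move=> w b l ww wE; set c := (_ - 1) * _.
have gain i : level_ell D w <= wlen w + c - eps * (count (fun p => p.1 == i) l)%:R.
  have occ : disjoint_occurrences (u i) (count (fun p => p.1 == i) l) w.
    by rewrite wE; exact: assemble_occurrences.
  apply: le_trans ((gain0 i).2 _ _ _ (mD i) ww occ) _.
  by rewrite lerD2l lerN2 ler_wpM2r // bigmin_le_cond.
have base : level_ell D w <= wlen w + c.
  have := level_ell_le et out_t out_S sec_t act_e hwt hrep hadm D ww.
  by have := ell_le_wlen hwt ww; rewrite /c; lra.
have : \sum_(i < n) level_ell D w <= \sum_(i < n) (wlen w + c -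
    eps * (count (fun p => p.1 == i) l)%:R) by exact: ler_sum.
rewrite sumr_const card_ord big_split /= sumr_const card_ord sumrN -mulr_sumr.
rewrite -natr_sum sum_count_fst -[leLHS]mulr_natl -[X in _ <= X - _]mulr_natl => sum_le.
suff : n.+1%:R * (level_ell D w - (wlen w + c)) <= - (eps * (size l)%:R).
  rewrite mulrC -ler_pdivlMr ?ltr0n // mulNr.
  by rewrite [eps / _ * _]mulrAC; move: (_ / n.+1%:R) => y; lra.
by rewrite -natr1 mulrDl mul1r; lra.
Qed.

Hypothesis hbad : exists M : nat, (0 < M)%N /\ forall L : R, 0 < L ->
  ([set w | bad_word e wt (range u) w /\ ell e wt w = L] #<= `I_M)%card.

(** It matters that [delta] depends on [s] but not on [r]: the contraction can then be iterated. *)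
Lemma growth_bound_contract (s : R) : 0 < s ->
  exists delta, [/\ 0 < delta, delta < 1 & forall r r', 0 < r -> growth_bound r ->
    s <= r' -> (1 - delta) * r <= r' -> growth_bound r'].
Proof.
move=> s0; have [D [c [eps [eps0 gain]]]] := assemble_gain.
have [M [_ bad]] := hbad; have s2 : 0 < s / 2 by rewrite divr_gt0.
have [rho [rho0 rho1 [Z bZ]]] := sum_bounded_assemble hwt
  (fun i => (good_word (hgood i)).1) s2 bad.
have /choice[d dP] : forall w, exists p : seq A * seq ('I_n * seq A),
    reduced_word e wt w -> [/\ bad_word e wt (range u) p.1,
      forall q, q \in p.2 -> bad_word e wt (range u) q.2 & w = assemble u p.1 p.2].
  move=> w; have [wr|wr] := pselect (reduced_word e wt w); last first.
    by exists ([::], [::]).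
  have [b [l bl]] := bad_decomposition hwt (fun i => (good_word (hgood i)).2) wr.
  by exists (b, l).
pose tau := - ln rho; have tau0 : 0 < tau by rewrite oppr_gt0 ln_lt0 ?rho0.
(* More than (s / 2 / tau) |w| cuts save at least eps (s / 2 / tau) |w|; the cap 1/2 keeps [delta]
   below 1. *)
pose delta := Num.min (eps * (s / 2 / tau)) (1 / 2).
have del0 : 0 < delta by rewrite lt_min !mulr_gt0 ?invr_gt0 //=; lra.
have delE : delta <= eps * (s / 2 / tau) by rewrite ge_min lexx.
have del1 : delta < 1.
  by apply: (@le_lt_trans _ _ (1 / 2)); [rewrite ge_min lexx orbT | lra].
exists delta; split => // r r' r0 gr sr' rr'.
have [Y bY] := sum_bounded_level_ell gr D.
have bD := sum_boundedD (sum_bounded_le (fun w nw =>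
  conj (is_normal_reduced hwt nw) (lexx _)) (bZ d dP))
  (sum_boundedZ (expR_ge0 (r * c)) bY).
eexists; apply: sum_bounded_le bD => w nw; split => //.
have wr := is_normal_reduced hwt nw; have [ww _] := wr.
have w0 := wlen_ge0 hwt ww; have [_ _ wE] := dP _ wr.
set k := size (d w).2.
have rhoE : rho ^+ k = expR (- tau * k%:R).
  by rewrite expRM_natr /tau opprK lnK.
rewrite rhoE -!expRD.
(* With few cuts, half of the exponent [s] compensates for [rho ^+ k] and the other half feeds the
   decomposition series. With many cuts the level-[D] series at [r] dominates. *)
have [few|many] := leP (tau * k%:R) (s / 2 * wlen w).
  rewrite ler_wpDr ?expR_ge0 // ler_expR.
  by have := ler_wpM2r w0 sr'; lra.
rewrite ler_wpDl ?expR_ge0 // ler_expR.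
have kle : s / 2 / tau * wlen w <= k%:R.
  by rewrite mulrAC ler_pdivrMr // mulrC [_%:R * _]mulrC ltW // mulrC.
have := gain w _ _ ww wE; rewrite -/k => gw.
have : level_ell D w <= (1 - delta) * wlen w + c.
  have := ler_wpM2l (ltW eps0) kle; have := ler_wpM2r w0 delE; lra.
move=> /(ler_wpM2l (ltW r0)); have := ler_wpM2r w0 rr'; lra.
Qed.

Lemma growth_bound_all (s : R) : 0 < s -> growth_bound s.
Proof.
move=> s0; have [r r0 gr] := growth_bound_large hwt.
have [delta [d0 d1 contract]] := growth_bound_contract s0.
have contract_le (q : R) : 0 < q -> (1 - delta) * q <= q.
  by move=> q0; have := mulr_ge0 (ltW d0) (ltW q0); lra.
(* Truncating at [s] keeps every step within the range of the contraction; the truncated sequence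
   equals [s] after finitely many steps. *)
have gk k : growth_bound (Num.max s ((1 - delta) ^+ k * r)).
  elim: k => [|k IH].
    apply: (contract r) => //; rewrite ?le_max ?lexx // expr0 mul1r.
    by rewrite contract_le ?orbT.
  apply: (contract _ _ _ IH); first by rewrite lt_max s0.
    by rewrite le_max lexx.
  rewrite exprS -mulrA maxr_pMr; last by lra.
  by rewrite ge_max !le_max contract_le // lexx orbT.
have lim : (1 - delta) ^+ k @[k --> \oo] --> (0 : R).
  by apply: cvg_expr; rewrite ger0_norm; lra.
have [k _ /(_ k (leqnn k))] : \forall k \near \oo, (1 - delta) ^+ k < s / r.
  by apply: (cvgr_lt _ lim); rewrite divr_gt0.
rewrite ltr_pdivlMr // => /ltW sk; have := gk k.
by rewrite max_l.
Qed.
End Growth.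

(** * Growth of balls *)

Lemma cvg_root_subexponential (R : realType) (a : nat -> nat) :
  (forall n, (0 < a n)%N) ->
  (forall s : R, 0 < s -> exists Z, forall n, (a n)%:R <= Z * expR (s * n%:R)) ->
  ((a n)%:R : R) `^ (n%:R^-1) @[n --> \oo] --> (1 : R).
Proof.
move=> a0 sub; apply/cvgrPdist_le => eps eps0.
(* Half of [eta] bounds the growth; the other half absorbs the constant [Z] once n is at least Z /
   (eta / 2). *)
pose eta := ln (1 + eps).
have eta0 : 0 < eta by rewrite ln_gt0 // ltrDl.
have eta2 : 0 < eta / 2 by rewrite divr_gt0.
have [Z aZ] := sub _ eta2.
have Z0 : 0 <= Z.
  by have := le_trans (ler0n _ _) (aZ 0%N); rewrite mulr0 expR0 mulr1.
exists (Num.truncn (Z / (eta / 2))).+1 => // n /= Nn.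
have n0 : 0 < (n%:R : R) by rewrite ltr0n (leq_trans _ Nn).
have an1 : 1 <= ((a n)%:R : R) by rewrite ler1n.
have ale : (a n)%:R <= expR (eta * n%:R).
  apply: (le_trans (aZ n)).
  rewrite (_ : eta * n%:R = eta / 2 * n%:R + eta / 2 * n%:R); last by lra.
  rewrite expRD ler_pM2r ?expR_gt0 //.
  apply: le_trans (expR_ge1Dx _).
  have : Z / (eta / 2) <= n%:R.
    by apply: le_trans (ltW (truncnS_gt _)) _; rewrite ler_nat.
  by rewrite ler_pdivrMr ?divr_gt0 // mulrC; lra.
have in0 : 0 <= (n%:R^-1 : R) by rewrite invr_ge0 ltW.
have lo : 1 <= ((a n)%:R : R) `^ n%:R^-1.
  have := @ge0_ler_powR _ _ in0 1 (a n)%:R; rewrite powR1.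
  by apply; rewrite ?nnegrE ?ler0n.
have hi : ((a n)%:R : R) `^ n%:R^-1 <= 1 + eps.
  rewrite -[1 + eps]lnK ?posrE ?addr_gt0 // -/eta.
  rewrite -[eta](mulfK (lt0r_neq0 n0)) expRM.
  by rewrite ge0_ler_powR ?nnegrE ?ler0n ?expR_ge0.
by rewrite distrC ger0_norm; lra.
Qed.

Section Balls.
Context (A : automaton) (e t : A).
Hypotheses (out_t : forall x, out t x = ~~ x)
  (out_S : forall a x, a != t -> out a x = x)
  (sec_t : forall x, sec t x = e) (act_e : is_identity e).
Context (R : realType) (wt : A -> R).
Hypothesis hwt : forall a : A, a != e -> 0 < wt a.

(** States are involutions, so the inverses allowed in [word_ball] are states again. *)
Lemma word_ball_eval n f : word_ball (range (@act A)) n f ->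
  exists l : seq A, (size l <= n)%N /\ f = eval l.
Proof.
move=> [s [sn gens ->]].
have {}gens g : g \in s -> exists a : A, g = act a.
  move=> /gens[[a _ <-]|[_ [[a _ <-] ag ga]]]; exists a => //.
  have aK := actK out_t out_S sec_t act_e a.
  by apply/funext => y; rewrite -{1}[y]aK ag.
have [l [ls ->]] : exists l : seq A,
    size l = size s /\ foldr (fun g h => g \o h) id s = eval l.
  elim: s gens {sn} => [_|g s IH gens]; first by exists [::].
  have [l [ls lE]] : exists l : seq A,
      size l = size s /\ foldr (fun g h => g \o h) id s = eval l.
    by apply: IH => h hs; apply: gens; rewrite inE hs orbT.
  have [a ->] := gens g (mem_head _ _).
  by exists (a :: l); rewrite /= ls lE.
by exists l; rewrite ls.
Qed.

Lemma finite_word_ball n : finite_set (word_ball (range (@act A)) n).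
Proof.
apply: (@sub_finite_set _ _ ((fun l : {bseq n of A} => eval l) @` setT)).
  by move=> f /word_ball_eval[l [ln ->]]; exists (Bseq ln).
exact/finite_image/finite_finset.
Qed.

Lemma eval_filter (l : seq A) : eval [seq a <- l | a != e] = eval l.
Proof.
apply/funext => y; elim: l => //= a l IH; case: eqP => [->|_] /=; rewrite IH //.
Qed.

(** Every element of the ball has a normal form of length at most c n, hence contributes at least
    exp(-s n) to the series at s / c. *)
Lemma card_word_ball_le : (forall s, 0 < s -> growth_bound e wt s) ->
  forall s : R, 0 < s -> exists Z, forall n,
    (#|` fset_set (word_ball (range (@act A)) n)|%:R : R) <= Z * expR (s * n%:R).
Proof.
move=> gb s s0; have [c c0 cP] := wt_max wt.
have sc0 : 0 < s / c by rewrite divr_gt0.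
have [Z bZ] := gb _ sc0; exists Z => n.
have nf f : exists w : seq A, word_ball (range (@act A)) n f ->
    [/\ is_normal e wt w, eval w = f & wlen wt w <= c * n%:R].
  have [/word_ball_eval[l [ln fE]]|nf] := pselect (word_ball (range (@act A)) n f);
    last by exists [::].
  pose w := [seq a <- l | a != e].
  have ww : is_word e w by rewrite /is_word mem_filter eqxx.
  have [nr nE] := normal_formP hwt ww.
  exists (normal_form e wt w) => _; split; first exact: is_normal_form.
    by rewrite nE fE eval_filter.
  rewrite nr.2 (eq_ell e wt nE) (le_trans (ell_le_wlen hwt ww)) //.
  have : wlen wt w <= c * (size w)%:R.
    elim: (w) => [|a v IH]; first by rewrite wlen_nil mulr0.
    by rewrite wlen_cons -natr1 mulrDr mulr1 addrC lerD.
  move=> /le_trans; apply; rewrite ler_pM2l // ler_nat.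
  by rewrite size_filter (leq_trans (count_size _ _)).
have {nf}[nf nfP] := choice nf.
set B := fset_set _.
have memB f : f \in B -> word_ball (range (@act A)) n f.
  by rewrite in_fset_set ?inE //; exact: finite_word_ball.
have un : uniq (map nf B).
  rewrite map_inj_in_uniq ?fset_uniq // => f g /memB/nfP[_ fE _] /memB/nfP[_ gE _] fg.
  by rewrite -fE -gE fg.
have := bZ _ un; rewrite big_map => le.
rewrite -ler_pdivrMr ?expR_gt0 // -expRN.
apply: le_trans (le _); last by move=> w /mapP[f /memB/nfP[? _ _] ->].
rewrite [leLHS](_ : _ = \sum_(f <- B) expR (- (s * n%:R))).
  rewrite [leLHS]big_seq [leRHS]big_seq; apply: ler_sum => f /memB/nfP[_ _ fl].
  by rewrite ler_expR mulNr lerN2 mulrAC ler_pdivrMr // -mulrA ler_pM2l // mulrC.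
by rewrite big_const_seq count_predT iter_addr_0 mulr_natl.
Qed.

End Balls.

Theorem theorem3p23 (R : realType) (A : automaton) (e t : A)
    (hA : kneading A) (hpre : preperiodic A)
    (he : is_identity e) (ht : active t)
    (wt : A -> R) (hwt : forall a : A, a != e -> 0 < wt a)
    (rep : (seq bool -> seq bool) -> seq A)
    (hrep : minimal_reps e t wt rep)
    (hadm : admissible e t wt rep)
    (n : nat) (u : 'I_n -> seq A) (m : 'I_n -> nat)
    (hgood : forall i : 'I_n, good e t wt rep (m i) (u i))
    (hbad : exists M : nat, (0 < M)%N /\ forall L : R, 0 < L ->
      ([set w | bad_word e wt (range u) w /\ ell e wt w = L] #<= `I_M)%card) :
  subexponential_growth R (group_of A).
Proof.
have et := active_neq_identity hA he ht.
have out_t := out_active hA ht.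
have out_S := fun a x => @out_inactive A t hA ht a x.
have sec_t := fun x => sec_active hA he ht x hpre.
exists (range (@act A)); split => //; first exact/finite_image/finite_finset.
apply: cvg_root_subexponential => [k|s s0].
  rewrite cardfs_gt0; apply/fset0Pn; exists id.
  rewrite in_fset_set; last exact: (finite_word_ball out_t out_S sec_t he).
  by rewrite inE; exists [::].
apply: (card_word_ball_le out_t out_S sec_t he hwt) s0 => r.
exact: (growth_bound_all et out_t out_S sec_t he hwt hrep hadm hgood hbad).
Qed.
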